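(* Let $n\equiv 3\pmod 4$, i.e. $n=4m+3$ with $m\ge 0$. Then each of the polynomials $A_{4m+3}^+(t)$ and $A_{4m+3}^-(t)$ can be written as a sum of three gamma positive polynomials.
   Context: For a permutation $\pi=\pi_1\cdots\pi_n$ of $[n]$ let $\mathsf{des}(\pi)=|\{i\in[n-1]:\pi_i>\pi_{i+1}\}|$. Let $\mathfrak{S}_n$ be the symmetric group and $\mathcal{A}_n$ the alternating group. $A_n^+(t)=\sum_{\pi\in\mathcal{A}_n}t^{\mathsf{des}(\pi)}$ and $A_n^-(t)=\sum_{\pi\in\mathfrak{S}_n\setminus\mathcal{A}_n}t^{\mathsf{des}(\pi)}$. For a nonzero polynomial $f(t)=\sum_{i=r}^{N}a_it^i$ with $a_r\neq0\neq a_N$: $f$ is palindromic if $a_{r+i}=a_{N-i}$ for $0\le i\le\lfloor (N-r)/2\rfloor$; its center of symmetry is $(N+r)/2$; and $f$ is gamma positive if it is palindromic and $f(t)=\sum_{i=0}^{\lfloor (N-r)/2\rfloor}\gamma_i t^{r+i}(1+t)^{N-r-2i}$ with all $\gamma_i\geq 0$. *)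

(* Defs.v *)
From HB Require Import structures.
From mathcomp Require Import all_boot all_order all_algebra all_fingroup all_solvable.
Set Implicit Arguments.
Unset Strict Implicit.
Unset Printing Implicit Defensive.
Import Order.TTheory GRing.Theory Num.Theory.
Local Open Scope ring_scope.

(* Permutations act on {0, .., n-1}; the index i counts as a descent when it
   has a successor j = i + 1 in 'I_n and pi i > pi j. *)
Definition des (n : nat) (pi : 'S_n) : nat :=
  #|[set i : 'I_n | [exists j : 'I_n, (j == i.+1 :> nat) && (pi j < pi i)%N]]|.

Definition eulerian_plus (n : nat) : {poly rat} :=
  \sum_(pi : 'S_n | pi \in ('Alt_('I_n))%g) 'X^(des pi).

Definition eulerian_minus (n : nat) : {poly rat} :=
  \sum_(pi : 'S_n | pi \notin ('Alt_('I_n))%g) 'X^(des pi).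

Section GammaPositivity.
Variable R : realFieldType.
Implicit Type f : {poly R}.

(* For f != 0, low_deg f and high_deg f are the exponents r and N of the lowest
   and highest nonzero terms; both are junk (0) for f = 0, which is excluded
   below. *)
Definition low_deg f : nat := find (fun a : R => a != 0) f.
Definition high_deg f : nat := (size f).-1.

Definition palindromic f : Prop :=
  f != 0 /\
  forall i : nat, (i <= (high_deg f - low_deg f)./2)%N ->
    f`_(low_deg f + i) = f`_(high_deg f - i).

Definition gamma_positive f : Prop :=
  let r := low_deg f in
  let N := high_deg f in
  palindromic f /\
  exists gamma : nat -> R,
    (forall i : nat, (i <= (N - r)./2)%N -> 0 <= gamma i) /\
    f = \sum_(0 <= i < ((N - r)./2).+1)
          gamma i *: ('X^(r + i) * (1 + 'X) ^+ (N - r - 2 * i)).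

Definition sum_of_three_gamma_positive f : Prop :=
  exists f1 f2 f3 : {poly R},
    [/\ gamma_positive f1, gamma_positive f2, gamma_positive f3
      & f = f1 + f2 + f3].

End GammaPositivity.

(* Main.v *)
Require Import Defs.
From HB Require Import structures.
From mathcomp Require Import all_boot all_order all_algebra all_fingroup all_solvable.
From mathcomp Require Import ring lra zify.

(** Write A_n for the Eulerian polynomial and D_n for its version signed by the
    sign of the permutation, so that A_n^+ and A_n^- are (A_n + D_n) / 2 and
    (A_n - D_n) / 2.  Restricting the sums to the permutations with first letter
    below j gives recursions in (n, j), from which D_n = (1 - t)^k A_(n-k) with
    k = floor(n / 2), and A_(n+1) = (1 + n t) A_n + t (1 - t) A_n', follow; the
    latter yields the recursion of the gamma coefficients of A_n.

    For n = 4m+3 put d = 4m+1.  Then D_n = (1 - t) u with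
    u = (1 - t)^(2m) A_(2m+2), and since (1 - t)^2 = (1 + t)^2 - 4t, u has an
    expansion in the polynomials t^i (1 + t)^(d-2i), with signed coefficients
    c_i.  These satisfy |c_i| <= gamma_(n,i), so writing |u| for the polynomial
    with coefficients |c_i|,
      A_n + D_n = (A_n - (1 + t) |u|) + (|u| + u) + t (|u| - u)
    is a sum of three polynomials with nonnegative gamma coefficients; for
    A_n - D_n replace u by - u.  A vanishing summand is replaced by a third
    of a nonzero one. *)

Set Implicit Arguments.
Unset Strict Implicit.
Unset Printing Implicit Defensive.
Import Order.TTheory GRing.Theory Num.Theory.
Local Open Scope ring_scope.

Lemma des_sum n (s : 'S_n.+1) :
  des s = (\sum_(i < n) (s (lift ord0 i) < s (widen_ord (leqnSn n) i)))%N.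
Proof.
rewrite /des cardsE -sum1_card big_mkcond big_ord_recr /=.
rewrite [X in (_ + X)%N]ifF ?addn0; last first.
  apply/negbTE/existsP => -[j /andP[/eqP jn _]].
  by have := ltn_ord j; rewrite jn ltnn.
apply: eq_bigr => i _; rewrite unfold_in.
case: ifP => [/existsP[j /andP[/eqP ji]]|/existsP no_descent].
  by have -> : j = lift ord0 i by [apply: val_inj; rewrite /= ji]; move->.
case: ltnP => // descent; case: no_descent; exists (lift ord0 i).
by rewrite descent eqxx.
Qed.

Lemma des_lift_perm n (j : 'I_n.+2) (s : 'S_n.+1) :
  des (lift_perm ord0 j s) = ((s ord0 < j) + des s)%N.
Proof.
rewrite !des_sum big_ord_recl; congr (_ + _)%N.
  have -> : widen_ord (leqnSn n.+1) ord0 = ord0 by apply: val_inj.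
  rewrite lift_perm_lift lift_perm_id /= /bump.
  by congr (nat_of_bool _); case: leqP; lia.
apply: eq_bigr => i _; congr (nat_of_bool _).
have -> : widen_ord (leqnSn n.+1) (lift ord0 i)
  = lift ord0 (widen_ord (leqnSn n) i) by apply: val_inj.
rewrite !lift_perm_lift /= /bump.
by do 2!case: leqP; lia.
Qed.

Lemma lift_perm_bij n (i : 'I_n.+1) :
  bijective (fun p : 'I_n.+1 * 'S_n => lift_perm i p.1 p.2).
Proof.
apply: inj_card_bij => [[j s] [k t] /= /permP eq_lift|].
  have jk : j = k by have := eq_lift i; rewrite !lift_perm_id.
  subst k; congr pair; apply/permP => x.
  by have := eq_lift (lift i x); rewrite !lift_perm_lift => /lift_inj.
by rewrite card_prod !card_Sn card_ord.
Qed.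

Lemma big_lift_perm (T : Type) (idx : T) (op : Monoid.com_law idx) n
    (i j : 'I_n.+1) (F : 'S_n.+1 -> T) :
  \big[op/idx]_(s : 'S_n.+1 | s i == j) F s =
  \big[op/idx]_(s : 'S_n) F (lift_perm i j s).
Proof.
rewrite (reindex _ (onW_bij _ (lift_perm_bij i))) /=.
under eq_bigl => p do rewrite lift_perm_id -[_ == _]andbT.
rewrite -(pair_big_dep (fun k => k == j) (fun _ _ => true)
  (fun k s => F (lift_perm i k s))) /=.
by rewrite big_pred1_eq.
Qed.

Section WeightedEulerian.
Variable R : comNzRingType.
Implicit Types (w : {poly R}) (n j : nat).

Definition perm_weight w n (s : 'S_n) : {poly R} :=
  w ^+ odd_perm s * 'X^(des s).

Definition weighted_eulerian w n : {poly R} := \sum_(s : 'S_n) perm_weight w s.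

Definition head_lt_eulerian w n j : {poly R} :=
  \sum_(s : 'S_n.+1 | (s ord0 < j)%N) perm_weight w s.

Lemma head_lt_eulerian0 w n : head_lt_eulerian w n 0 = 0.
Proof. exact: big_pred0_eq. Qed.

Lemma head_lt_eulerian_full w n :
  head_lt_eulerian w n n.+1 = weighted_eulerian w n.+1.
Proof. by apply: eq_bigl => s; rewrite ltn_ord. Qed.

Lemma weighted_eulerian1 w : weighted_eulerian w 1 = 1.
Proof.
rewrite /weighted_eulerian (big_pred1 1%g) => [|s].
  by rewrite /perm_weight odd_perm1 des_sum big_ord0 mulr1.
by apply/esym/eqP/permP => i; rewrite [s i]ord1 perm1 ord1.
Qed.

Lemma perm_weight_lift_perm w n (j : 'I_n.+2) (s : 'S_n.+1) : w ^+ 2 = 1 ->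
  perm_weight w (lift_perm ord0 j s) =
  w ^+ j * ('X^(s ord0 < j)%N * perm_weight w s).
Proof.
move=> w2; rewrite /perm_weight odd_lift_perm des_lift_perm /=.
rewrite -[odd_perm s in LHS]oddb -oddD -modn2 expr_mod // !exprD.
by rewrite -mulrA [w ^+ s * (_ * _)]mulrCA.
Qed.

(* Removing a first letter j creates a factor 'X exactly when the next letter is
   smaller than j; permutations starting below j thus count 'X instead of 1. *)
Lemma sum_perm_weight_head w n (j : 'I_n.+2) : w ^+ 2 = 1 ->
  \sum_(s : 'S_n.+2 | s ord0 == j) perm_weight w s =
  w ^+ j * (weighted_eulerian w n.+1 - (1 - 'X) * head_lt_eulerian w n j).
Proof.
move=> w2; rewrite big_lift_perm.
under eq_bigr do rewrite perm_weight_lift_perm //.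
rewrite -big_distrr /weighted_eulerian /head_lt_eulerian; congr (_ * _).
rewrite (bigID (fun s : 'S_n.+1 => (s ord0 < j)%N)) /=.
under eq_bigr => s -> do rewrite expr1.
under [X in _ + X = _]eq_bigr => s /negbTE -> do rewrite mul1r.
rewrite [in RHS](bigID (fun s : 'S_n.+1 => (s ord0 < j)%N)) /= -big_distrr.
by rewrite /=; ring.
Qed.

Lemma head_lt_eulerianS w n j : w ^+ 2 = 1 -> (j <= n.+1)%N ->
  head_lt_eulerian w n.+1 j.+1 = head_lt_eulerian w n.+1 j +
  w ^+ j * (weighted_eulerian w n.+1 - (1 - 'X) * head_lt_eulerian w n j).
Proof.
move=> w2 jn; pose k := Ordinal (jn : (j < n.+2)%N).
rewrite -(@sum_perm_weight_head w n k) //.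
rewrite {1}/head_lt_eulerian (bigID (fun s : 'S_n.+2 => (s ord0 < j)%N)) /=.
by congr (_ + _); apply: eq_bigl => s; rewrite -?(inj_eq val_inj) /=; lia.
Qed.

Lemma head_lt_eulerian1 w n : w ^+ 2 = 1 ->
  head_lt_eulerian w n.+1 1 = weighted_eulerian w n.+1.
Proof.
move=> w2; rewrite head_lt_eulerianS // !head_lt_eulerian0.
by rewrite mulr0 subr0 mul1r add0r.
Qed.

End WeightedEulerian.

Local Notation eulerian := (weighted_eulerian 1).
Local Notation signed_eulerian := (weighted_eulerian (-1)).

Section SignedEulerian.
Variable R : comNzRingType.
Implicit Types (u : {poly R}) (n j : nat).

Let sqr1 : 1 ^+ 2 = 1 :> {poly R}. Proof. exact: expr1n. Qed.
Let sqrN1 : (-1) ^+ 2 = 1 :> {poly R}. Proof. by rewrite sqrrN sqr1. Qed.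

Lemma head_lt_signed_eulerianSS n j : (j <= n.+1)%N ->
  head_lt_eulerian (-1) n.+2 j.+2 = head_lt_eulerian (-1) n.+2 j +
  (1 - 'X) * (signed_eulerian n.+1 - (1 - 'X) * head_lt_eulerian (-1) n j)
  :> {poly R}.
Proof.
move=> jn; rewrite !head_lt_eulerianS //; last exact: leqW.
by rewrite exprS -signr_odd; case: (odd j); rewrite ?expr1 ?expr0; ring.
Qed.

Lemma head_lt_signed_eulerianE n j : odd (n + j) -> (j <= n.+1)%N ->
  head_lt_eulerian (-1) n j =
  (1 - 'X) ^+ uphalf n * head_lt_eulerian 1 n./2 (uphalf j) :> {poly R}.
Proof.
elim/ltn_ind: n j => -[|[|n]] IHn.
- case=> [|[|j]] // _ _.
  by rewrite !head_lt_eulerian_full !weighted_eulerian1 mulr1.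
- case=> [|[|[|j]]] // _ _; first by rewrite !head_lt_eulerian0 mulr0.
  rewrite head_lt_eulerianS // head_lt_eulerian1 // !head_lt_eulerian_full.
  by rewrite !weighted_eulerian1; ring.
elim/ltn_ind=> -[|[|j]] IHj odd_nj le_jn.
- by rewrite !head_lt_eulerian0 mulr0.
- rewrite !head_lt_eulerian1 // -!head_lt_eulerian_full IHn //=; last by lia.
  by rewrite uphalf_half (_ : odd n = false) //; lia.
rewrite head_lt_signed_eulerianSS ?IHj; try lia.
rewrite -head_lt_eulerian_full !IHn; try lia.
rewrite [uphalf j.+2]/= [n.+2./2]/= [uphalf n.+2]/= [uphalf n.+1]/=.
rewrite head_lt_eulerianS //; last by lia.
by rewrite expr1n head_lt_eulerian_full exprS mul1r; ring.
Qed.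

Lemma signed_eulerianE n :
  signed_eulerian n = (1 - 'X) ^+ n./2 * eulerian (uphalf n) :> {poly R}.
Proof.
case: n => [|n].
  rewrite mul1r; apply: eq_bigr => s _; congr (_ * _).
  by rewrite (_ : s = 1%g) ?odd_perm1 //; apply/permP => -[].
rewrite -head_lt_eulerian_full head_lt_signed_eulerianE //; last by lia.
by rewrite head_lt_eulerian_full.
Qed.

Definition eulerian_op n u : {poly R} :=
  (1 + n%:R * 'X) * u + 'X * (1 - 'X) * u^`().

Fact eulerian_op_is_linear n : linear (eulerian_op n).
Proof.
by move=> a u v; rewrite /eulerian_op derivD derivZ -!mul_polyC; ring.
Qed.

HB.instance Definition _ n :=
  GRing.isLinear.Build R {poly R} {poly R} _ (eulerian_op n)
    (eulerian_op_is_linear n).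

Lemma eulerian_op_1BXM n u :
  eulerian_op n.+1 ((1 - 'X) * u) = (1 - 'X) * eulerian_op n u.
Proof.
by rewrite /eulerian_op derivM derivB derivC derivX -natr1; ring.
Qed.

Lemma eulerian_opS n u : eulerian_op n.+1 u = eulerian_op n u + 'X * u.
Proof. by rewrite /eulerian_op -natr1; ring. Qed.

Lemma head_lt_eulerian_op n j : (j <= n.+1)%N ->
  head_lt_eulerian 1 n.+1 j = eulerian_op n (head_lt_eulerian 1 n j)
  :> {poly R}.
Proof.
elim: n j => [|n IHn]; elim=> [|j IHj] jn.
- by rewrite !head_lt_eulerian0 linear0.
- move: jn; rewrite ltnS leqn0 => /eqP ->.
  rewrite head_lt_eulerian1 // head_lt_eulerian_full weighted_eulerian1.
  by rewrite /eulerian_op derivC; ring.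
- by rewrite !head_lt_eulerian0 linear0.
have eulerianSS : eulerian n.+2 = eulerian_op n.+1 (eulerian n.+1) :> {poly R}.
  rewrite -[LHS]head_lt_eulerian_full head_lt_eulerianS // IHn //.
  by rewrite head_lt_eulerian_full expr1n eulerian_opS; ring.
rewrite head_lt_eulerianS ?(ltnW jn) // IHj ?(ltnW jn) //.
rewrite [in RHS]head_lt_eulerianS // !expr1n !mul1r linearD linearB /=.
by rewrite eulerianSS eulerian_op_1BXM IHn.
Qed.

Lemma eulerianS n :
  eulerian n.+2 = eulerian_op n.+1 (eulerian n.+1) :> {poly R}.
Proof.
by rewrite -head_lt_eulerian1 // head_lt_eulerian_op // head_lt_eulerian1.
Qed.

Lemma horner1_eulerian n : (eulerian n).[1] = n`!%:R :> R.
Proof.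
rewrite horner_sum -card_Sn -sum1_card natr_sum; apply: eq_bigr => s _.
by rewrite /perm_weight expr1n mul1r hornerXn expr1n.
Qed.

End SignedEulerian.

Lemma weighted_eulerianE n w :
  weighted_eulerian w n = eulerian_plus n + w * eulerian_minus n.
Proof.
rewrite /weighted_eulerian (bigID (fun s : 'S_n => s \in ('Alt_('I_n))%g)) /=.
rewrite /eulerian_plus /eulerian_minus big_distrr /=.
congr (_ + _); apply: eq_bigr => s; rewrite Alt_even /perm_weight.
  by move=> /negbTE ->; rewrite mul1r.
by rewrite negbK => ->.
Qed.

Lemma eulerian_plusE n : eulerian_plus n =
  2^-1 *: (eulerian n + signed_eulerian n).
Proof.
rewrite !weighted_eulerianE [X in _ *: X](_ : _ = 2 *: eulerian_plus n).
  by rewrite scalerK.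
by rewrite scaler_nat; ring.
Qed.

Lemma eulerian_minusE n : eulerian_minus n =
  2^-1 *: (eulerian n - signed_eulerian n).
Proof.
rewrite !weighted_eulerianE [X in _ *: X](_ : _ = 2 *: eulerian_minus n).
  by rewrite scalerK.
by rewrite scaler_nat; ring.
Qed.

(* The subtraction d' - 2 * i' is truncated, which makes the coefficients vanish
   beyond d / 2. *)
Fixpoint gamma_coef (d i : nat) : nat :=
  if d is d'.+1 then
    i.+1 * gamma_coef d' i +
    (if i is i'.+1 then 2 * (d' - 2 * i') * gamma_coef d' i' else 0)
  else (i == 0)%N.

Lemma gamma_coefS d i : gamma_coef d.+1 i =
  (i.+1 * gamma_coef d i +
   (if i is j.+1 then 2 * (d - 2 * j) * gamma_coef d j else 0))%N.
Proof. by []. Qed.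

Lemma gamma_coef_eq0 d i : (d < 2 * i)%N -> gamma_coef d i = 0%N.
Proof.
elim: d i => [|d IHd] [|i] di //; rewrite gamma_coefS IHd ?muln0; last by lia.
by have -> : (d - 2 * i = 0)%N by lia.
Qed.

Lemma leq_gamma_coef d i : (gamma_coef d i <= gamma_coef d.+1 i)%N.
Proof. by rewrite gamma_coefS mulSn -addnA leq_addr. Qed.

Lemma leq_gamma_coef_add2 d i : odd d ->
  (gamma_coef d i.+1 + 4 * gamma_coef d i <= gamma_coef d.+2 i.+1)%N.
Proof.
move=> d_odd; rewrite [leqRHS]gamma_coefS; apply: leq_add.
  exact: leq_trans (leq_gamma_coef _ _) (leq_pmull _ _).
have [/gamma_coef_eq0 -> //|di] := ltnP d (2 * i).
by apply: leq_mul (leq_gamma_coef _ _); lia.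
Qed.

Section GammaExpansion.
Variable R : comNzRingType.
Implicit Types (f : {poly R}) (c : nat -> R) (d i : nat).

Definition gamma_basis d i : {poly R} := 'X^i * (1 + 'X) ^+ (d - 2 * i).

Definition gamma_sum d c : {poly R} :=
  \sum_(0 <= i < d./2.+1) c i *: gamma_basis d i.

Definition gamma_supported d c := forall i, (d < 2 * i)%N -> c i = 0.

Definition gamma_expansion d f c := gamma_supported d c /\ f = gamma_sum d c.

Lemma gamma_sum_widen d e c : gamma_supported d c -> (d./2 <= e)%N ->
  gamma_sum d c = \sum_(0 <= i < e.+1) c i *: gamma_basis d i.
Proof.
move=> c0 de; rewrite [RHS](big_cat_nat (n := d./2.+1)) //=.
rewrite [X in _ + X]big_nat_cond [X in _ + X]big1 ?addr0 // => i.
by rewrite andbT => /andP[di _]; rewrite c0 ?scale0r //; lia.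
Qed.

Lemma gamma_expansion_linear (L : {linear {poly R} -> {poly R}})
    (a b : nat -> R) d d' f c c' :
  (d <= d')%N ->
  (forall i, (2 * i <= d)%N ->
     L (gamma_basis d i) =
     a i *: gamma_basis d' i + b i *: gamma_basis d' i.+1) ->
  (forall i, (2 * i <= d)%N -> (d' < 2 * i.+1)%N -> b i = 0) ->
  (forall i, c' i = a i * c i + (if i is i'.+1 then b i' * c i' else 0)) ->
  gamma_expansion d f c -> gamma_expansion d' (L f) c'.
Proof.
move=> dd' L_basis b0 c'E [c0 ->].
have c'0 : gamma_supported d' c'.
  case=> [//|i] d'i; rewrite c'E c0 ?mulr0 ?add0r; last by lia.
  have [di|di] := leqP (2 * i) d; last by rewrite c0 ?mulr0.
  by rewrite b0 ?mul0r.
split=> //; rewrite (gamma_sum_widen c0 (e := d')); last by lia.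
rewrite (gamma_sum_widen c'0 (e := d'.+1)); last by lia.
under [RHS]eq_bigr do rewrite c'E scalerDl.
rewrite big_split /= [X in X + _]big_nat_recr // [X in _ + X]big_nat_recl //=.
rewrite c0 ?mulr0 ?scale0r ?addr0 ?add0r; last by lia.
rewrite -big_split linear_sum; apply: eq_bigr => i _ /=; rewrite linearZ /=.
have [di|/c0 ->] := leqP (2 * i) d; last by rewrite !mulr0 !scale0r addr0.
by rewrite L_basis // scalerDr !scalerA ![c i * _]mulrC.
Qed.

Lemma gamma_expansion_1DXM d f c :
  gamma_expansion d f c -> gamma_expansion d.+1 ((1 + 'X) * f) c.
Proof.
apply: (gamma_expansion_linear (L := (1 + 'X) \*o idfun)
          (a := fun=> 1) (b := fun=> 0)) => //.
- move=> i di; rewrite /= /gamma_basis subSn // scale1r scale0r addr0.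
  by rewrite exprS mulrCA.
- by case=> [|i]; rewrite mul1r ?mul0r addr0.
Qed.

Lemma gamma_expansion_sqr1BXM d f c : gamma_expansion d f c ->
  gamma_expansion d.+2 ((1 - 'X) ^+ 2 * f)
    (fun i => c i - (if i is i'.+1 then 4 * c i' else 0)).
Proof.
apply: (gamma_expansion_linear (L := (1 - 'X) ^+ 2 \*o idfun)
          (a := fun=> 1) (b := fun=> - 4)) => //.
- by rewrite ltnW.
- move=> i di; rewrite /= /gamma_basis.
  have -> : (d.+2 - 2 * i = (d - 2 * i).+2)%N by lia.
  have -> : (d.+2 - 2 * i.+1 = d - 2 * i)%N by lia.
  rewrite !exprS scale1r -mul_polyC; move: ((1 + 'X) ^+ _) 'X^i => y x.
  by rewrite rmorphN /= rmorph_nat; ring.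
- by move=> i; lia.
- by case=> [|i]; rewrite mul1r ?mulNr ?subr0 ?addr0.
Qed.

Lemma eulerian_op_gamma_basis d i : (2 * i <= d)%N ->
  eulerian_op d.+1 (gamma_basis d i) =
  i.+1%:R *: gamma_basis d.+1 i +
  (2 * (d - 2 * i))%:R *: gamma_basis d.+1 i.+1.
Proof.
move=> di; have [e ->] : exists e, d = (2 * i + e)%N.
  by exists (d - 2 * i)%N; lia.
rewrite /gamma_basis /eulerian_op !scaler_nat.
have -> : (2 * i + e - 2 * i = e)%N by lia.
have -> : ((2 * i + e).+1 - 2 * i = e.+1)%N by lia.
have -> : ((2 * i + e).+1 - 2 * i.+1 = e.-1)%N by lia.
have mulX_derivXn : 'X * 'X^i^`() = i%:R * 'X^i :> {poly R}.
  case: i {di} => [|i]; rewrite derivXn ?mulr0 ?mul0r //.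
  by rewrite -mulr_natl mulrCA exprS.
rewrite derivM (deriv_exp (1 + 'X)) derivD derivC derivX add0r mul1r.
transitivity ((1 + (2 * i + e).+1%:R * 'X) * ('X^i * (1 + 'X) ^+ e)
    + (1 - 'X) * ('X * 'X^i^`() * (1 + 'X) ^+ e
                  + 'X^(i.+1) * ((1 + 'X) ^+ e.-1 *+ e)) : {poly R}).
  by rewrite exprS; ring.
rewrite mulX_derivXn.
by case: e {di} => [|e]; rewrite /= !exprS; ring.
Qed.

Lemma gamma_expansion_eulerian d :
  gamma_expansion d (eulerian d.+1) (fun i => (gamma_coef d i)%:R).
Proof.
elim: d => [|d IHd].
  split=> [[|i] //|].
  by rewrite weighted_eulerian1 /gamma_sum big_nat1 /gamma_basis scale1r mulr1.
rewrite eulerianS; apply: (gamma_expansion_linear (a := fun i => i.+1%:R)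
  (b := fun i => (2 * (d - 2 * i))%:R)) IHd => //.
- exact: eulerian_op_gamma_basis.
- by move=> i di di'; rewrite (_ : d - 2 * i = 0)%N ?muln0 //; lia.
- by case=> [|i]; rewrite gamma_coefS natrD !natrM.
Qed.

Lemma gamma_sumZ d c x : gamma_sum d (fun i => x * c i) = x *: gamma_sum d c.
Proof. by rewrite scaler_sumr; apply: eq_bigr => i _; rewrite scalerA. Qed.

Lemma gamma_sumD d c c' :
  gamma_sum d (fun i => c i + c' i) = gamma_sum d c + gamma_sum d c'.
Proof. by rewrite -big_split; apply: eq_bigr => i _; rewrite scalerDl. Qed.

Lemma gamma_sumB d c c' :
  gamma_sum d (fun i => c i - c' i) = gamma_sum d c - gamma_sum d c'.
Proof. by rewrite -sumrB; apply: eq_bigr => i _; rewrite scalerBl. Qed.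

Lemma gamma_expansionZ d f c x :
  gamma_expansion d f c -> gamma_expansion d (x *: f) (fun i => x * c i).
Proof.
by move=> [c0 ->]; split; [move=> i /c0 ->; rewrite mulr0 | rewrite gamma_sumZ].
Qed.

Lemma coef_exp1DX n j : ((1 + 'X) ^+ n : {poly R})`_j = 'C(n, j)%:R.
Proof.
elim: n j => [|n IHn] j; first by rewrite coef1 bin0n.
rewrite exprS mulrDl mul1r coefD coefXM; case: j => [|j] /=.
  by rewrite IHn !bin0 addr0.
by rewrite !IHn binS natrD.
Qed.

Lemma coef_gamma_basis d i j :
  (gamma_basis d i)`_j = if (j < i)%N then 0 else 'C(d - 2 * i, j - i)%:R.
Proof. by rewrite coefXnM coef_exp1DX. Qed.

Lemma coef_gamma_sum_gt d c j : (d < j)%N -> (gamma_sum d c)`_j = 0.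
Proof.
move=> dj; rewrite coef_sum big_nat_cond big1 // => i.
rewrite andbT => /andP[_ id]; rewrite coefZ coef_gamma_basis.
by case: ltnP => ij; rewrite ?bin_small ?mulr0 //; lia.
Qed.

Lemma coef_gamma_sum_sym d c j : (j <= d)%N ->
  (gamma_sum d c)`_(d - j) = (gamma_sum d c)`_j.
Proof.
move=> jd; rewrite !coef_sum; apply: eq_big_nat => i /andP[_ id].
rewrite !coefZ !coef_gamma_basis; congr (_ * _).
case: ltnP => dij; case: ltnP => ij //.
- by rewrite bin_small //; lia.
- by rewrite bin_small //; lia.
- by rewrite -bin_sub; [congr ('C(_, _)%:R); lia | lia].
Qed.

Lemma coef0_gamma_sum d c : (gamma_sum d c)`_0 = c 0%N.
Proof.
rewrite coef_sum big_nat_recl //= big1 => [|i _].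
  by rewrite coefZ coef_gamma_basis /= bin0 mulr1 addr0.
by rewrite coefZ coef_gamma_basis /= mulr0.
Qed.

Lemma gamma_sum_shift d c k :
  (2 * k <= d)%N -> (forall i, (i < k)%N -> c i = 0) ->
  gamma_sum d c = 'X^k * gamma_sum (d - 2 * k) (fun i => c (k + i)%N).
Proof.
move=> kd c0; rewrite /gamma_sum (big_cat_nat (n := k)) //=; last by lia.
rewrite big_nat_cond big1 ?add0r => [|i /andP[/andP[_ ik] _]]; last first.
  by rewrite c0 // scale0r.
rewrite -{1}[k]addn0 addnC big_addn big_distrr /=.
have -> : (d./2.+1 - k = (d - 2 * k)./2.+1)%N by lia.
apply: eq_bigr => i _; rewrite -scalerAr /gamma_basis mulrA -exprD addnC.
by congr (_ *: (_ * _ ^+ _)); lia.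
Qed.

End GammaExpansion.

Section GammaPositive.
Variable R : realFieldType.
Implicit Types (f g : {poly R}) (a b c : nat -> R) (r d : nat).

Lemma low_degE f r : f`_r != 0 -> (forall i, (i < r)%N -> f`_i = 0) ->
  low_deg f = r.
Proof.
move=> fr f0; have size_f : (r < size f)%N.
  by rewrite ltnNge; apply: contra fr => /(nth_default 0) ->.
have has_f : has (fun x => x != 0) f by apply/(has_nthP 0); exists r.
apply/eqP; rewrite eqn_leq /low_deg.
apply/andP; split; rewrite leqNgt; apply/negP.
  by move/(before_find 0); rewrite fr.
by move/f0 => find0; have := nth_find 0 has_f; rewrite find0 eqxx.
Qed.

Lemma high_degE f N : f`_N != 0 -> (forall i, (N < i)%N -> f`_i = 0) ->
  high_deg f = N.
Proof.
move=> fN f0; rewrite /high_deg; suff -> : size f = N.+1 by [].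
apply/eqP; rewrite eqn_leq; apply/andP; split; first exact/leq_sizeP.
by rewrite ltnNge; apply: contra fN => /(nth_default 0) ->.
Qed.

Lemma gamma_positive_XnM_gamma_sum r d c : c 0%N != 0 ->
  (forall i, 0 <= c i) -> gamma_positive ('X^r * gamma_sum d c).
Proof.
move=> c0 c_ge0; set f := 'X^r * _.
have coef_f i : f`_(r + i) = (gamma_sum d c)`_i.
  by rewrite coefXnM ltnNge leq_addr /= addKn.
have low_f : low_deg f = r.
  apply: low_degE => [|i ir]; last by rewrite coefXnM ir.
  by rewrite -[r]addn0 coef_f coef0_gamma_sum.
have high_f : high_deg f = (r + d)%N.
  apply: high_degE => [|i rdi].
    by rewrite coef_f -coef_gamma_sum_sym // subnn coef0_gamma_sum.
  have -> : (i = r + (i - r))%N by lia.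
  by rewrite coef_f coef_gamma_sum_gt //; lia.
rewrite /gamma_positive /palindromic low_f high_f addKn; split; [split|].
- by apply: contraNneq c0 => f0; rewrite -(coef0_gamma_sum d) -coef_f f0 coef0.
- move=> i id; have -> : (r + d - i = r + (d - i))%N by lia.
  by rewrite !coef_f coef_gamma_sum_sym //; lia.
- exists c; split=> //.
  rewrite /f big_distrr; apply: eq_bigr => i _ /=.
  by rewrite -scalerAr /gamma_basis mulrA -exprD.
Qed.

Definition gamma_nonnegative f :=
  exists r d c, (forall i, 0 <= c i) /\ f = 'X^r * gamma_sum d c.

Lemma gamma_nonnegative_positive f :
  gamma_nonnegative f -> f != 0 -> gamma_positive f.
Proof.
move=> [r [d [c [c_ge0 ->]]]] f0.
have coef_neq0 : exists k, (k <= d./2)%N && (c k != 0).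
  have [/hasP[k]|/hasPn c0] :=
    boolP (has (fun k => c k != 0) (index_iota 0 d./2.+1)).
    by rewrite mem_index_iota /= ltnS => kd ck; exists k; rewrite kd.
  case/eqP: f0; rewrite /gamma_sum big_seq big1 ?mulr0 // => k /c0.
  by rewrite negbK => /eqP ->; rewrite scale0r.
case: (ex_minnP coef_neq0) => k /andP[kd ck] k_min.
rewrite (gamma_sum_shift (k := k)) ?mulrA -?exprD; first 1 last.
- by lia.
- move=> i ik; apply/eqP; apply: contraLR (ik) => ci.
  by rewrite -leqNgt k_min // ci andbT; lia.
by apply: gamma_positive_XnM_gamma_sum; rewrite ?addn0.
Qed.

Lemma gamma_nonnegativeZ x f :
  0 <= x -> gamma_nonnegative f -> gamma_nonnegative (x *: f).
Proof.
move=> x0 [r [d [c [c_ge0 ->]]]]; exists r, d, (fun i => x * c i); split.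
  by move=> i; rewrite mulr_ge0.
by rewrite gamma_sumZ scalerAr.
Qed.

Lemma gamma_nonnegative_pad f g : gamma_nonnegative f -> gamma_nonnegative g ->
  g != 0 -> exists2 x, 0 <= x <= 3^-1 & gamma_positive (f + x *: g).
Proof.
move=> f_ge0 g_ge0 g0; have [->|f0] := eqVneq f 0.
  exists 3^-1; first by rewrite lexx invr_ge0 ler0n.
  rewrite add0r; apply: gamma_nonnegative_positive.
    by apply: gamma_nonnegativeZ; rewrite // invr_ge0 ler0n.
  by rewrite scaler_eq0 invr_eq0 pnatr_eq0.
exists 0; first by rewrite lexx invr_ge0 ler0n.
by rewrite scale0r addr0; apply: gamma_nonnegative_positive.
Qed.

Lemma sum_of_three_gamma_nonnegative_neq0 f1 f2 f3 : gamma_nonnegative f1 ->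
  gamma_nonnegative f2 -> gamma_nonnegative f3 -> f3 != 0 ->
  sum_of_three_gamma_positive (f1 + f2 + f3).
Proof.
move=> f1_ge0 f2_ge0 f3_ge0 f30.
have [x1 /andP[x1_ge0 x1_le] f1_pos] := gamma_nonnegative_pad f1_ge0 f3_ge0 f30.
have [x2 /andP[x2_ge0 x2_le] f2_pos] := gamma_nonnegative_pad f2_ge0 f3_ge0 f30.
exists (f1 + x1 *: f3), (f2 + x2 *: f3), ((1 - x1 - x2) *: f3); split=> //.
  have x_gt0 : 0 < 1 - x1 - x2 by lra.
  apply: gamma_nonnegative_positive.
    exact: gamma_nonnegativeZ (ltW x_gt0) _.
  by rewrite scaler_eq0 negb_or gt_eqF.
by rewrite !scalerBl scale1r; ring.
Qed.

Lemma sum_of_three_gamma_nonnegative f1 f2 f3 : gamma_nonnegative f1 ->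
  gamma_nonnegative f2 -> gamma_nonnegative f3 -> f1 + f2 + f3 != 0 ->
  sum_of_three_gamma_positive (f1 + f2 + f3).
Proof.
move=> f1_ge0 f2_ge0 f3_ge0 f0.
have [f30|f30] := eqVneq f3 0; last exact: sum_of_three_gamma_nonnegative_neq0.
have [f20|f20] := eqVneq f2 0.
  rewrite -addrA addrC; apply: sum_of_three_gamma_nonnegative_neq0 => //.
  by apply: contraNneq f0 => ->; rewrite f20 f30 !addr0.
by rewrite addrAC; apply: sum_of_three_gamma_nonnegative_neq0.
Qed.

Definition gamma_bounded d a f :=
  exists2 c, gamma_expansion d f c & forall i, `|c i| <= a i.

Lemma gamma_bounded_le d a b f :
  (forall i, a i <= b i) -> gamma_bounded d a f -> gamma_bounded d b f.
Proof. by move=> ab [c fc ca]; exists c => // i; apply: le_trans (ab i). Qed.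

Lemma gamma_boundedZ d a f x y : `|y| <= x ->
  gamma_bounded d a f -> gamma_bounded d (fun i => x * a i) (y *: f).
Proof.
move=> yx [c fc ca]; exists (fun i => y * c i); first exact: gamma_expansionZ.
by move=> i; rewrite normrM ler_pM.
Qed.

(* Each factor (1 - t)^2 = (1 + t)^2 - 4t changes the gamma coefficients by
   c_i - 4 c_(i-1), while two Eulerian steps add at least 4 c_(i-1). *)
Lemma gamma_bounded_exp1BX_eulerian d s : odd d ->
  gamma_bounded (d + 2 * s) (fun i => (gamma_coef (d + 2 * s) i)%:R)
    ((1 - 'X) ^+ (2 * s) * eulerian d.+1).
Proof.
move=> d_odd; elim: s => [|s [c fc c_le]].
  rewrite addn0 mul1r; exists (fun i => (gamma_coef d i)%:R).
    exact: gamma_expansion_eulerian.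
  by move=> i; rewrite ger0_norm.
have -> : (d + 2 * s.+1 = (d + 2 * s).+2)%N by lia.
rewrite mulnS exprD -mulrA; eexists; first exact: gamma_expansion_sqr1BXM fc.
case=> [|i].
  by rewrite subr0 (le_trans (c_le 0%N)) // ler_nat !gamma_coefS; lia.
rewrite (le_trans (ler_normB _ _)) // normrM normr_nat.
apply: (@le_trans _ _
  (gamma_coef (d + 2 * s) i.+1 + 4 * gamma_coef (d + 2 * s) i)%:R).
  by rewrite natrD natrM lerD // ler_wpM2l.
by rewrite ler_nat leq_gamma_coef_add2 // oddD mul2n odd_double d_odd.
Qed.

Lemma sum_of_three_gamma_positive_bounded d a f g :
  gamma_expansion d.+1 f a -> gamma_bounded d a g -> f.[1] != 0 ->
  sum_of_three_gamma_positive (f + (1 - 'X) * g).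
Proof.
move=> [_ ->] [c [c0 ->] c_le] f1; pose n i := `|c i|.
have nE : (1 + 'X) * gamma_sum d n = gamma_sum d.+1 n.
  have [|//] := @gamma_expansion_1DXM _ d (gamma_sum d n) n.
  by split=> // i /c0 ci; rewrite /n ci normr0.
have sum3 : gamma_sum d.+1 a + (1 - 'X) * gamma_sum d c =
    gamma_sum d.+1 (fun i => a i - n i) + gamma_sum d (fun i => n i + c i)
    + 'X * gamma_sum d (fun i => n i - c i).
  by rewrite !gamma_sumB gamma_sumD -nE; ring.
rewrite sum3; apply: sum_of_three_gamma_nonnegative.
- exists 0%N, d.+1, (fun i => a i - n i); rewrite mul1r; split=> // i.
  by rewrite subr_ge0 c_le.
- exists 0%N, d, (fun i => n i + c i); rewrite mul1r; split=> // i.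
  by rewrite /n -lerBlDr sub0r -normrN ler_norm.
- exists 1%N, d, (fun i => n i - c i); split=> // i.
  by rewrite subr_ge0 ler_norm.
- rewrite -sum3; apply: contraNneq f1 => /(congr1 (horner^~ 1)).
  by rewrite !hornerE subrr mul0r addr0 => ->.
Qed.

Lemma sum_of_three_gamma_positive_eulerian m (x y : R) : x != 0 -> `|y| <= x ->
  sum_of_three_gamma_positive
    (x *: eulerian (4 * m + 3) + y *: signed_eulerian (4 * m + 3)).
Proof.
move=> x0 yx; pose d := (2 * m).+1.
have nE : (4 * m + 3 = (d + 2 * m).+2)%N by rewrite /d; lia.
have signedE : signed_eulerian (4 * m + 3) =
    (1 - 'X) * ((1 - 'X) ^+ (2 * m) * eulerian d.+1) :> {poly R}.
  by rewrite signed_eulerianE mulrA -exprS; congr (_ ^+ _ * eulerian _); lia.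
rewrite signedE nE scalerAr.
apply: (sum_of_three_gamma_positive_bounded (d := d + 2 * m)).
- exact: gamma_expansionZ (gamma_expansion_eulerian _ _).
- apply: gamma_boundedZ => //; apply: gamma_bounded_le; last first.
    by apply: gamma_bounded_exp1BX_eulerian; rewrite /d; lia.
  by move=> i; rewrite ler_nat leq_gamma_coef.
- by rewrite hornerZ horner1_eulerian mulf_neq0 // pnatr_eq0 -lt0n fact_gt0.
Qed.

End GammaPositive.

Theorem theorem3 (m : nat) :
  sum_of_three_gamma_positive (eulerian_plus (4 * m + 3)) /\
  sum_of_three_gamma_positive (eulerian_minus (4 * m + 3)).
Proof.
rewrite eulerian_plusE eulerian_minusE scalerBr scalerDr -scaleNr.
by split; apply: sum_of_three_gamma_positive_eulerian; rewrite ?normrN.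
Qed.
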